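(* If $R$ is a left GF-closed ring, then the class $\mathscr{GF}(R)$ of all Gorenstein flat left $R$-modules is closed under direct summands.
   Context: All rings are associative with identity and all modules are unitary. A left $R$-module $M$ is Gorenstein flat if there exists an exact sequence of flat left $R$-modules $\cdots\to F_1\to F_0\to F^0\to F^1\to\cdots$ such that $M\cong \mathrm{Im}(F_0\to F^0)$ and such that $I\otimes_R -$ leaves the sequence exact whenever $I$ is an injective right $R$-module. $\mathscr{GF}(R)$ denotes the class of all Gorenstein flat left $R$-modules. A ring $R$ is left GF-closed if $\mathscr{GF}(R)$ is closed under extensions: for every short exact sequence of left $R$-modules $0\to A\to B\to C\to 0$ with $A$ and $C$ Gorenstein flat, $B$ is Gorenstein flat. *)

(* Defs.v *)
From HB Require Import structures.
From mathcomp Require Import all_boot all_algebra.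
From mathcomp Require Import boolp.
From mathcomp Require Import freeg.

Set Implicit Arguments.
Unset Strict Implicit.
Unset Printing Implicit Defensive.

Import GRing.Theory.
Local Open Scope ring_scope.
Local Open Scope quotient_scope.

(* Rings are [pzRingType]s (associative, unital, possibly zero).  Left
   R-modules are [lmodType R]; right R-modules are [lmodType R^c], where
   [r *: m] stands for m r. *)

Section Tensor.
Context (R : pzRingType) (M : lmodType R^c) (N : lmodType R).

Inductive tens_rel : {freeg (M * N)%type} -> Prop :=
| TensDl m m' n : tens_rel (<<(m + m', n)>> - <<(m, n)>> - <<(m', n)>>)
| TensDr m n n' : tens_rel (<<(m, n + n')>> - <<(m, n)>> - <<(m, n')>>)
| TensZ (r : R) m n : tens_rel (<<((r : R^c) *: m, n)>> - <<(m, r *: n)>>)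
| Tens0 : tens_rel 0
| TensB x y : tens_rel x -> tens_rel y -> tens_rel (x - y).

Definition tens_rels : {pred {freeg (M * N)%type}} :=
  [pred x | `[< tens_rel x >]].

Lemma tens_relsP x : reflect (tens_rel x) (x \in tens_rels).
Proof. exact: asboolP. Qed.

Lemma tens_rels_zmod_closed : zmod_closed tens_rels.
Proof.
split=> [|x y /tens_relsP hx /tens_relsP hy]; first exact/tens_relsP/Tens0.
exact/tens_relsP/TensB.
Qed.

HB.instance Definition _ :=
  GRing.isZmodClosed.Build _ tens_rels tens_rels_zmod_closed.

(* The abelian group M (x)_R N. *)
Definition tensor : zmodType := Quotient.quot tens_rels.

Definition tens_pi (x : {freeg (M * N)%type}) : tensor :=
  \pi_(Quotient.quot tens_rels) x.

Definition tens_repr (x : tensor) : {freeg (M * N)%type} :=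
  repr (x : Quotient.quot tens_rels).

Definition tens (m : M) (n : N) : tensor := tens_pi <<(m, n)>>.

Lemma tens_reprK x : tens_pi (tens_repr x) = x.
Proof. exact: reprK. Qed.

Lemma tens_piP x y : tens_pi x = tens_pi y <-> tens_rel (x - y).
Proof.
split=> [xy|/tens_relsP]; last by rewrite Quotient.idealrBE => /eqP.
by apply/tens_relsP; rewrite Quotient.idealrBE; apply/eqP.
Qed.

Lemma tens_piB : zmod_morphism tens_pi.
Proof. by move=> x y; rewrite /tens_pi Quotient.pi_add Quotient.pi_opp. Qed.

End Tensor.

Section TensorMap.
Context (R : pzRingType) (M M' : lmodType R^c) (N N' : lmodType R).
Context (f : {linear M -> M'}) (g : {linear N -> N'}).

Definition tens_map_free :
    {freeg (M * N)%type} -> {freeg (M' * N')%type} :=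
  fglift (fun mn => <<(f mn.1, g mn.2)>>).

(* f (x) g; by [tens_mapE] and additivity it does not depend on the
   representative. *)
Definition tens_map (x : tensor M N) : tensor M' N' :=
  tens_pi (tens_map_free (tens_repr x)).

Lemma tens_map_freeB : zmod_morphism tens_map_free.
Proof. exact: lift_is_additive. Qed.

Lemma tens_map_freeU m n : tens_map_free <<(m, n)>> = <<(f m, g n)>>.
Proof. by rewrite /tens_map_free liftU scale1r. Qed.

Lemma tens_map_rel x : tens_rel x -> tens_rel (tens_map_free x).
Proof.
elim=> [m m' n|m n n'|r m n||{}x y _ hx _ hy].
- by rewrite !tens_map_freeB !tens_map_freeU raddfD; exact: TensDl.
- by rewrite !tens_map_freeB !tens_map_freeU raddfD; exact: TensDr.
- by rewrite !tens_map_freeB !tens_map_freeU !linearZ; exact: TensZ.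
- by rewrite -(subrr 0) tens_map_freeB subrr; exact: Tens0.
- by rewrite tens_map_freeB; exact: TensB.
Qed.

Lemma tens_map_pi x : tens_map (tens_pi x) = tens_pi (tens_map_free x).
Proof.
by apply/tens_piP; rewrite -tens_map_freeB; apply/tens_map_rel/tens_piP/tens_reprK.
Qed.

Lemma tens_mapE m n : tens_map (tens m n) = tens (f m) (g n).
Proof. by rewrite tens_map_pi tens_map_freeU. Qed.

Lemma tens_map_is_zmod_morphism : zmod_morphism tens_map.
Proof.
move=> x y; rewrite -[x in LHS]tens_reprK -[y in LHS]tens_reprK -tens_piB.
by rewrite tens_map_pi tens_map_freeB tens_piB.
Qed.

HB.instance Definition _ :=
  GRing.isZmodMorphism.Build _ _ tens_map tens_map_is_zmod_morphism.

End TensorMap.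

Definition exact_at (A B C : zmodType) (f : A -> B) (g : B -> C) : Prop :=
  forall y, g y = 0 <-> exists x, f x = y.

(* Exactness of
   ... -> Fl 1 -> Fl 0 -e-> Fr 0 -> Fr 1 -> ... *)
Definition exact_seq (Fl Fr : nat -> zmodType)
    (dl : forall n, Fl n.+1 -> Fl n) (e : Fl 0 -> Fr 0)
    (dr : forall n, Fr n -> Fr n.+1) : Prop :=
  [/\ forall n, exact_at (dl n.+1) (dl n),
      exact_at (dl 0) e,
      exact_at e (dr 0)
    & forall n, exact_at (dr n) (dr n.+1)].

(* The functor - (x)_R F from right R-modules to abelian groups is exact. *)
Definition flat (R : pzRingType) (F : lmodType R) : Prop :=
  forall (A B C : lmodType R^c) (f : {linear A -> B}) (g : {linear B -> C}),
    exact_at f g ->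
    exact_at (tens_map f (@idfun F)) (tens_map g (@idfun F)).

Definition injective_module (R : pzRingType) (I : lmodType R) : Prop :=
  forall (A B : lmodType R) (f : {linear A -> B}) (g : {linear A -> I}),
    injective f -> exists h : {linear B -> I}, forall x, h (f x) = g x.

(* [i] identifies M with the submodule Im e of Fr 0. *)
Definition gorenstein_flat (R : pzRingType) (M : lmodType R) : Prop :=
  exists (Fl Fr : nat -> lmodType R)
    (dl : forall n, {linear Fl n.+1 -> Fl n}) (e : {linear Fl 0 -> Fr 0})
    (dr : forall n, {linear Fr n -> Fr n.+1}),
  [/\ forall n, flat (Fl n) /\ flat (Fr n),
      exact_seq dl e dr,
      forall I : lmodType R^c, injective_module I ->
        exact_seq (fun n => tens_map (@idfun I) (dl n))
          (tens_map (@idfun I) e) (fun n => tens_map (@idfun I) (dr n))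
    & exists i : {linear M -> Fr 0}, injective i /\
        forall y, (exists x, i x = y) <-> (exists x, e x = y)].

Definition closed_under_extensions (R : pzRingType) (P : lmodType R -> Prop)
    : Prop :=
  forall (A B C : lmodType R) (f : {linear A -> B}) (g : {linear B -> C}),
    injective f -> exact_at f g -> (forall z, exists y, g y = z) ->
    P A -> P C -> P B.

Definition left_GF_closed (R : pzRingType) : Prop :=
  closed_under_extensions (@gorenstein_flat R).

Definition direct_summand (R : pzRingType) (M G : lmodType R) : Prop :=
  exists (N : lmodType R) (phi : {linear (M * N)%type -> G}), bijective phi.

Definition closed_under_direct_summands (R : pzRingType)
    (P : lmodType R -> Prop) : Prop :=
  forall M G : lmodType R, direct_summand M G -> P G -> P M.

(* Main.v *)
From HB Require Import structures.
Require Import Defs.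
From mathcomp Require Import all_boot all_algebra.
From mathcomp Require Import boolp freeg.

(** Let M be a direct summand of a Gorenstein flat module, seen as a retract
    [s : M -> G], [r : G -> M] with [r \o s = id].  A complete flat resolution
    of M is spliced together from short exact sequences, with no resolution of
    a complement of M and no Tor.

    A Gorenstein flat G sits in short exact sequences 0 -> G -> F -> G' -> 0
    and 0 -> G'' -> F' -> G -> 0 with F, F' flat, with G', G'' Gorenstein flat,
    and which stay exact under I (x) - for I injective ([gf_flat_envelope],
    [gf_flat_cover]): cut the complete resolution of G at one place.
    Conversely, if every module of some class has such an envelope and such a
    cover with third term in the class, then iterating both gives complete
    resolutions, so the class consists of Gorenstein flat modules
    ([gf_of_steps]).

    It remains to check these two properties for the class of retracts of
    Gorenstein flat modules, and this is where closure under extensions enters.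
    Embed M in F through G and let L = F / M.  Then
    0 -> G -> L (+) M -> G' -> 0 is exact, so L (+) M is Gorenstein flat and L
    is again in the class ([gf_retract_envelope]).  Dually, map F' onto M
    through G and let K be the kernel; then 0 -> G'' -> K (+) M -> G -> 0 is
    exact ([gf_retract_cover]).  Exactness under I (x) - only needs
    injectivity of one map, because tensoring is right exact
    ([tens_right_exact]). *)

Set Implicit Arguments.
Unset Strict Implicit.
Unset Printing Implicit Defensive.

Import GRing.Theory.
Local Open Scope ring_scope.
Local Open Scope quotient_scope.

Definition surj (A B : Type) (f : A -> B) : Prop := forall y, exists x, f x = y.

(** * Tensor products *)

Section TensorInduction.
Context (R : pzRingType) (M : lmodType R^c) (N : lmodType R).

HB.instance Definition _ :=
  GRing.isZmodMorphism.Build _ _ (@tens_pi R M N) (@tens_piB R M N).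

(** Pure tensors generate the tensor product as an abelian group, so a property
    stable under subtraction can be checked on them. *)
Lemma tensor_ind (P : tensor M N -> Prop) :
  P 0 -> (forall x y, P x -> P y -> P (x - y)) -> (forall m n, P (tens m n)) ->
  forall z, P z.
Proof.
move=> P0 PB Pt.
have PN x : P x -> P (- x) by rewrite -sub0r; exact: PB.
have PD x y : P x -> P y -> P (x + y).
  by move=> hx hy; rewrite -[y]opprK; apply/PB/PN.
have PU k mn : P (tens_pi << k *g mn >>).
  have -> : tens_pi << k *g mn >> = tens mn.1 mn.2 *~ k.
    by rewrite -raddfMz /= freegU_mulz intz -surjective_pairing.
  have PM n : P (tens mn.1 mn.2 *+ n).
    by elim: n => // n; rewrite mulrS; exact: PD.
  case: k => k; first exact: PM.
  by rewrite NegzE mulrNz; exact/PN/PM.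
move=> z; rewrite -[z]tens_reprK.
apply: (freeg_ind_dom0 (P := P \o @tens_pi R M N)) => [|k x D _ _ PD'] /=.
  by rewrite raddf0.
by rewrite raddfD; apply: PD; [exact: PU | exact: PD'].
Qed.

Lemma tensor_eq (Z : zmodType) (u v : {additive tensor M N -> Z}) :
  (forall m n, u (tens m n) = v (tens m n)) -> u =1 v.
Proof.
move=> uv; apply: tensor_ind => //; first by rewrite !raddf0.
by move=> x y ux uy; rewrite !raddfB ux uy.
Qed.

Lemma tensDl m m' n : tens (m + m') n = tens m n + tens m' n :> tensor M N.
Proof.
apply/eqP; rewrite -subr_eq0 opprD addrA -!raddfB; apply/eqP.
rewrite -[RHS](raddf0 (@tens_pi R M N)); apply/tens_piP.
by rewrite subr0; exact: TensDl.
Qed.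

Lemma tensDr m n n' : tens m (n + n') = tens m n + tens m n' :> tensor M N.
Proof.
apply/eqP; rewrite -subr_eq0 opprD addrA -!raddfB; apply/eqP.
rewrite -[RHS](raddf0 (@tens_pi R M N)); apply/tens_piP.
by rewrite subr0; exact: TensDr.
Qed.

Lemma tensZ (r : R) m n : tens ((r : R^c) *: m) n = tens m (r *: n) :> tensor M N.
Proof. by apply/tens_piP; exact: TensZ. Qed.

Lemma tensBr m n n' : tens m (n - n') = tens m n - tens m n' :> tensor M N.
Proof. by apply/esym/eqP; rewrite subr_eq -tensDr subrK. Qed.

Lemma tens0r m : tens m 0 = 0 :> tensor M N.
Proof. by have := tensBr m 0 0; rewrite !subrr. Qed.

End TensorInduction.

Section TensorFunctor.
Context (R : pzRingType) (I : lmodType R^c).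

Local Notation "I# f" := (tens_map (@idfun I) f) (at level 10).

Lemma tens_map_comp (A B C : lmodType R) (f : {linear A -> B})
    (g : {linear B -> C}) (h : {linear A -> C}) :
  (forall x, g (f x) = h x) -> forall z, I# g (I# f z) = I# h z.
Proof.
move=> gf; apply: (tensor_eq (u := I# g \o I# f)) => m n /=.
by rewrite !tens_mapE gf.
Qed.

Lemma tens_map_id (A : lmodType R) (h : {linear A -> A}) :
  (forall x, h x = x) -> forall z, I# h z = z.
Proof.
move=> hE; apply: (tensor_eq (v := idfun)) => m n /=.
by rewrite tens_mapE hE.
Qed.

Lemma tens_map0 (A B : lmodType R) (h : {linear A -> B}) :
  (forall x, h x = 0) -> forall z, I# h z = 0.
Proof.
move=> h0; apply: (tensor_eq (v := \0)) => m n /=.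
by rewrite tens_mapE h0 tens0r.
Qed.

Lemma tens_map_surj (A B : lmodType R) (g : {linear A -> B}) :
  surj g -> surj (I# g).
Proof.
move=> gS; apply: tensor_ind => [|x y [x' <-] [y' <-]|m n].
- by exists 0; rewrite raddf0.
- by exists (x' - y'); rewrite raddfB.
- by have [a <-] := gS n; exists (tens m a); rewrite tens_mapE.
Qed.

(** Lifting the second factor along a set-theoretic section of [g] is additive
    and balanced modulo the image of I (x) [f], so it inverts the map from the
    cokernel of I (x) [f] to I (x) C. *)
Lemma tens_right_exact (A B C : lmodType R) (f : {linear A -> B})
    (g : {linear B -> C}) :
  exact_at f g -> surj g -> exact_at (I# f) (I# g).
Proof.
move=> fg gS z; split; last first.
  case=> x <-; rewrite (tens_map_comp (h := g \o f)) //.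
  by apply: tens_map0 => a /=; apply/fg; exists a.
pose im y := exists x, (I# f) x = y.
have im0 : im 0 by exists 0; rewrite raddf0.
have imB x y : im x -> im y -> im (x - y).
  by case=> [x' <-] [y' <-]; exists (x' - y'); rewrite raddfB.
have imt m b : g b = 0 -> im (tens m b).
  by move=> /fg[a <-]; exists (tens m a); rewrite tens_mapE.
pose s c := sval (cid (gS c)).
have sK c : g (s c) = c by rewrite /s; case: cid.
pose lift (x : {freeg (I * C)%type}) : tensor I B :=
  tens_pi (fglift (fun mc => <<(mc.1, s mc.2)>>) x).
have liftB : zmod_morphism lift.
  by move=> x y; rewrite /lift lift_is_additive tens_piB.
have liftE m c : lift <<(m, c)>> = tens m (s c).
  by rewrite /lift liftU scale1r.
have lift_rel x : tens_rel x -> im (lift x).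
  elim=> [m m' c|m c c'|r m c||{}x y _ hx _ hy].
  - by rewrite !liftB !liftE tensDl addrAC addrK subrr.
  - rewrite !liftB !liftE -!tensBr; apply: imt.
    by rewrite !raddfB /= !sK addrAC addrK subrr.
  - rewrite !liftB !liftE tensZ -tensBr; apply: imt.
    by rewrite raddfB /= linearZ_LR /= !sK subrr.
  - by rewrite -(subrr 0) liftB subrr.
  - by rewrite liftB; exact: imB.
(* Lifting the image of a representative x of z gives back z modulo the image of
   I (x) [f]. *)
have [x [<- hx]] : exists x, tens_pi x = z /\
    im (lift (tens_map_free (@idfun I) g x) - z).
  elim/tensor_ind: z => [|_ _ [x [<- hx]] [y [<- hy]]|m b].
  - exists 0; split; first exact: raddf0.
    by rewrite subr0; apply: lift_rel; apply: tens_map_rel; exact: Tens0.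
  - exists (x - y); split; first by rewrite raddfB.
    rewrite tens_map_freeB liftB.
    by have := imB _ _ hx hy; rewrite !opprD !opprK addrACA.
  - exists <<(m, b)>>; split => //.
    rewrite tens_map_freeU liftE -tensBr; apply: imt.
    by rewrite raddfB /= sK subrr.
rewrite tens_map_pi -(raddf0 (@tens_pi R I C)) => /tens_piP.
rewrite subr0 => /lift_rel hl.
by rewrite -(subKr (lift (tens_map_free idfun g x)) (tens_pi x)); exact: imB.
Qed.

End TensorFunctor.

(** * Kernels, cokernels and factorizations *)

Section Modules.
Context (R : pzRingType).
Implicit Types A B C K X : lmodType R.

(** Kernels and cokernels are used only through their exactness; this lemma and
    [epi_factor] recover their universal properties from it. *)
Lemma mono_lift K A X (k : {linear K -> A}) (g : {linear X -> A}) :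
  injective k -> (forall x, exists y, k y = g x) ->
  exists h : {linear X -> K}, forall x, k (h x) = g x.
Proof.
move=> kI gk; pose h x := sval (cid (gk x)).
have hE x : k (h x) = g x by rewrite /h; case: cid.
have hL : linear h by move=> r x y; apply: kI; rewrite linearP !hE linearP.
pose hm := GRing.isLinear.Build _ _ _ _ h hL.
by exists (HB.pack_for {linear X -> K} h hm).
Qed.

Lemma epi_factor A C X (p : {linear A -> C}) (g : {linear A -> X}) :
  surj p -> (forall x, p x = 0 -> g x = 0) ->
  exists h : {linear C -> X}, forall x, h (p x) = g x.
Proof.
move=> pS gp; pose s c := sval (cid (pS c)).
have sK c : p (s c) = c by rewrite /s; case: cid.
have gE x y : p x = p y -> g x = g y.
  by move=> pxy; apply/eqP; rewrite -subr_eq0 -linearB gp // linearB pxy subrr.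
pose h c := g (s c).
have hL : linear h.
  by move=> r x y; rewrite /h -linearP; apply: gE; rewrite linearP !sK.
pose hm := GRing.isLinear.Build _ _ _ _ h hL.
by exists (HB.pack_for {linear C -> X} h hm) => x; apply: gE; rewrite sK.
Qed.

End Modules.

Section Kernel.
Context (R : pzRingType) (A B : lmodType R) (f : {linear A -> B}).

Definition in_kernel : {pred A} := [pred x | f x == 0].

Lemma in_kernel_submod : submod_closed in_kernel.
Proof.
split=> [|r x y]; rewrite !inE ?raddf0 //.
by move=> /eqP fx /eqP fy; rewrite linearP fx fy scaler0 addr0.
Qed.

HB.instance Definition _ :=
  GRing.isSubmodClosed.Build R A in_kernel in_kernel_submod.

Record kernel := Kernel { kernel_val : A; _ : kernel_val \in in_kernel }.

HB.instance Definition _ := [isSub for kernel_val].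
HB.instance Definition _ := [Choice of kernel by <:].
HB.instance Definition _ := [SubChoice_isSubLmodule of kernel by <:].

Lemma kernel_exists :
  exists (K : lmodType R) (k : {linear K -> A}), injective k /\ exact_at k f.
Proof.
exists kernel, (val : {linear kernel -> A}); split; first exact: val_inj.
move=> y; split=> [/eqP fy|[x <-]]; first by exists (Kernel fy).
exact/eqP/(valP x).
Qed.

End Kernel.

Section Cokernel.
Context (R : pzRingType) (A B : lmodType R) (f : {linear A -> B}).

Definition in_image : {pred B} := [pred y | `[< exists x, f x = y >]].

Lemma in_image_submod : submod_closed in_image.
Proof.
split=> [|r x y]; rewrite !inE; first by apply/asboolP; exists 0; rewrite raddf0.
move=> /asboolP[x' <-] /asboolP[y' <-]; apply/asboolP.
by exists (r *: x' + y'); rewrite linearP.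
Qed.

HB.instance Definition _ :=
  GRing.isSubmodClosed.Build R B in_image in_image_submod.

Definition cokernel : Type := Quotient.quot in_image.
HB.instance Definition _ := GRing.Zmodule.on cokernel.

Definition coker_pi (y : B) : cokernel := \pi_(Quotient.quot in_image) y.

Lemma coker_piP x y : coker_pi x = coker_pi y <-> exists a, f a = x - y.
Proof.
split=> [/eqP|fxy]; first by rewrite -Quotient.idealrBE inE => /asboolP.
by apply/eqP; rewrite -Quotient.idealrBE inE; apply/asboolP.
Qed.

Lemma coker_piB : zmod_morphism coker_pi.
Proof. by move=> x y; rewrite /coker_pi Quotient.pi_add Quotient.pi_opp. Qed.

HB.instance Definition _ := GRing.isZmodMorphism.Build B cokernel coker_pi coker_piB.

Lemma coker_pi_surj : surj coker_pi.
Proof. by move=> c; exists (repr (c : Quotient.quot in_image)); exact: reprK. Qed.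

Definition coker_scale (r : R) (c : cokernel) : cokernel :=
  coker_pi (r *: sval (cid (coker_pi_surj c))).

Lemma coker_scaleE r y : coker_scale r (coker_pi y) = coker_pi (r *: y).
Proof.
rewrite /coker_scale; case: cid => x /= /coker_piP[a fa].
by apply/coker_piP; exists (r *: a); rewrite linearZ_LR fa scalerBr.
Qed.

Fact coker_scaleA r s c : coker_scale r (coker_scale s c) = coker_scale (r * s) c.
Proof. by have [y <-] := coker_pi_surj c; rewrite !coker_scaleE scalerA. Qed.

Fact coker_scale1 : left_id 1 coker_scale.
Proof. by move=> c; have [y <-] := coker_pi_surj c; rewrite coker_scaleE scale1r. Qed.

Fact coker_scaleDr : right_distributive coker_scale +%R.
Proof.
move=> r c d; have [x <-] := coker_pi_surj c; have [y <-] := coker_pi_surj d.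
by rewrite -raddfD !coker_scaleE scalerDr raddfD.
Qed.

Fact coker_scaleDl c : {morph coker_scale^~ c : r s / r + s}.
Proof.
by have [x <-] := coker_pi_surj c; move=> r s; rewrite !coker_scaleE scalerDl raddfD.
Qed.

HB.instance Definition _ := GRing.Zmodule_isLmodule.Build R cokernel
  coker_scaleA coker_scale1 coker_scaleDr coker_scaleDl.

Fact coker_piZ : scalable coker_pi.
Proof. by move=> r y; rewrite -coker_scaleE. Qed.

HB.instance Definition _ :=
  GRing.isScalable.Build R B cokernel *:%R coker_pi coker_piZ.

Lemma cokernel_exists :
  exists (C : lmodType R) (q : {linear B -> C}), exact_at f q /\ surj q.
Proof.
exists cokernel, coker_pi; split; last exact: coker_pi_surj.
move=> y; have := coker_piP y 0; rewrite subr0 raddf0 => h; exact: h.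
Qed.

End Cokernel.

(** * Splicing short exact sequences *)

Definition ses (R : pzRingType) (A B C : lmodType R) (f : {linear A -> B})
    (g : {linear B -> C}) : Prop :=
  [/\ injective f, exact_at f g & surj g].

(** For the monomorphism of a short exact sequence, this says that the sequence
    stays exact under I (x) - for every injective I. *)
Definition inj_pure (R : pzRingType) (A B : lmodType R) (f : {linear A -> B}) :=
  forall I : lmodType R^c, injective_module I ->
    injective (tens_map (@idfun I) f).

Section Steps.
Context (R : pzRingType).
Implicit Types (A B C F K L M : lmodType R) (P : lmodType R -> Prop).

(** A short exact sequence 0 -> K -> F -> M -> 0 from which one step of the left
    half of a complete flat resolution can be built.  Unlike in the theory of
    covers and envelopes, the names carry no minimality condition. *)
Definition flat_cover P M :=
  exists F K (k : {linear K -> F}) (p : {linear F -> M}),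
  [/\ flat F, P K, ses k p & inj_pure k].

Definition flat_envelope P M :=
  exists F L (i : {linear M -> F}) (q : {linear F -> L}),
  [/\ flat F, P L, ses i q & inj_pure i].

Lemma exact_splice (K B X Y Z : zmodType) (f : K -> B) (g : B -> X)
    (s : Y -> K) (j : {additive X -> Z}) (d : Y -> B) (d' : B -> Z) :
  exact_at f g -> surj s -> injective j -> (forall x, d x = f (s x)) ->
  (forall x, d' x = j (g x)) -> exact_at d d'.
Proof.
move=> fg sS jI dE d'E y; rewrite d'E; split=> [jg|[x <-]].
  have /fg[x <-] : g y = 0 by apply: jI; rewrite jg raddf0.
  by have [z <-] := sS x; exists z; rewrite dE.
suff -> : g (d x) = 0 by rewrite raddf0.
by apply/fg; rewrite dE; exists (s x).
Qed.

(** Stated for abelian groups, so that it applies both to the modules and to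
    their tensor products.  The term [L n] is the image of [Fr n] in
    [Fr n.+1]. *)
Lemma exact_seq_splice (K Fl Fr L : nat -> zmodType)
    (k : forall n, {additive K n.+1 -> Fl n}) (p : forall n, Fl n -> K n)
    (i : {additive K 0 -> Fr 0}) (q : forall n, Fr n -> L n)
    (j : forall n, {additive L n -> Fr n.+1})
    (dl : forall n, Fl n.+1 -> Fl n) (e : Fl 0 -> Fr 0)
    (dr : forall n, Fr n -> Fr n.+1) :
    (forall n, injective (k n)) -> (forall n, exact_at (k n) (p n)) ->
    (forall n, surj (p n)) -> injective i -> exact_at i (q 0) ->
    (forall n, injective (j n)) -> (forall n, exact_at (j n) (q n.+1)) ->
    (forall n, surj (q n)) ->
    (forall n x, dl n x = k n (p n.+1 x)) -> (forall x, e x = i (p 0 x)) ->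
    (forall n x, dr n x = j n (q n x)) ->
  exact_seq dl e dr.
Proof.
move=> kI kp pS iI iq jI jq qS dlE eE drE; split=> [n|||n].
- exact: exact_splice (kp n.+1) (pS n.+2) (kI n) _ _.
- exact: exact_splice (kp 0) (pS 1) iI _ _.
- exact: exact_splice iq (pS 0) (jI 0) _ _.
- exact: exact_splice (jq n) (qS n) (jI n.+1) _ _.
Qed.

(** An element of I (x) K killed by I (x) [k] lifts to I (x) B, where it becomes
    a cycle; it is then a boundary, and boundaries die in K. *)
Lemma image_inj_pure (A B C K : lmodType R) (f : {linear A -> B})
    (d : {linear B -> C}) (p : {linear B -> K}) (k : {linear K -> C}) :
  exact_at f d -> injective k -> surj p -> (forall x, d x = k (p x)) ->
  (forall I : lmodType R^c, injective_module I ->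
    exact_at (tens_map (@idfun I) f) (tens_map (@idfun I) d)) ->
  inj_pure k.
Proof.
move=> fd kI pS dE tfd I Iinj.
apply: raddf_inj => z kz; have [y zE] := tens_map_surj (I := I) pS z.
have /(tfd I Iinj)[x yE] : tens_map (@idfun I) d y = 0.
  by rewrite -(tens_map_comp (I := I) (f := p) (g := k)) // zE.
rewrite -zE -yE (tens_map_comp (I := I) (h := p \o f)) // tens_map0 // => a /=.
by apply: kI; rewrite -dE raddf0; apply/fd; exists a.
Qed.

(** Choosing covers and envelopes repeatedly, starting from M on both sides,
    yields short exact sequences that splice at M. *)
Lemma gf_of_steps P :
  (forall M, P M -> flat_cover P M) -> (forall M, P M -> flat_envelope P M) ->
  forall M, P M -> gorenstein_flat M.
Proof.
move=> cov env M PM.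
pose T := {M : lmodType R | P M}.
pose M0 : T := exist _ M PM.
have nextl (X : T) : {Y : T & {F : lmodType R & {k : {linear sval Y -> F} &
   {p : {linear F -> sval X} | [/\ flat F, ses k p & inj_pure k]}}}}.
  case: X => X /cov/cid[F /cid[K /cid[k /cid[p [Ff PK kp kI]]]]] /=.
  by exists (exist _ K PK), F, k, p.
have nextr (X : T) : {Y : T & {F : lmodType R & {i : {linear sval X -> F} &
   {q : {linear F -> sval Y} | [/\ flat F, ses i q & inj_pure i]}}}}.
  case: X => X /env/cid[F /cid[L /cid[i /cid[q [Ff PL iq iI]]]]] /=.
  by exists (exist _ L PL), F, i, q.
pose K n := iter n (fun X => projT1 (nextl X)) M0.
pose L n := iter n (fun X => projT1 (nextr X)) M0.
pose Fl n := projT1 (projT2 (nextl (K n))).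
pose Fr n := projT1 (projT2 (nextr (L n))).
pose k n : {linear sval (K n.+1) -> Fl n} :=
  projT1 (projT2 (projT2 (nextl (K n)))).
pose p n : {linear Fl n -> sval (K n)} :=
  sval (projT2 (projT2 (projT2 (nextl (K n))))).
pose i n : {linear sval (L n) -> Fr n} :=
  projT1 (projT2 (projT2 (nextr (L n)))).
pose q n : {linear Fr n -> sval (L n.+1)} :=
  sval (projT2 (projT2 (projT2 (nextr (L n))))).
have kpP n : [/\ flat (Fl n), ses (k n) (p n) & inj_pure (k n)].
  exact: svalP (projT2 (projT2 (projT2 (nextl (K n))))).
have iqP n : [/\ flat (Fr n), ses (i n) (q n) & inj_pure (i n)].
  exact: svalP (projT2 (projT2 (projT2 (nextr (L n))))).
have kp n : ses (k n) (p n) by case: (kpP n).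
have iq n : ses (i n) (q n) by case: (iqP n).
exists Fl, Fr, (fun n => k n \o p n.+1), (i 0 \o p 0), (fun n => i n.+1 \o q n).
have kI n : injective (k n) by case: (kp n).
have kpE n : exact_at (k n) (p n) by case: (kp n).
have pS n : surj (p n) by case: (kp n).
have iI n : injective (i n) by case: (iq n).
have iqE n : exact_at (i n) (q n) by case: (iq n).
have qS n : surj (q n) by case: (iq n).
split=> [n||I Iinj|].
- by split; [case: (kpP n) | case: (iqP n)].
- apply: (exact_seq_splice (K := fun n => sval (K n)) (Fl := Fl) (Fr := Fr)
    (L := fun n => sval (L n.+1)) (k := k) (p := p) (i := i 0) (q := q)
    (j := fun n => i n.+1)) => //.
  + exact: (iI 0).
  + exact: (iqE 0).
  + by move=> n; exact: (iI n.+1).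
- apply: (exact_seq_splice (K := fun n => tensor I (sval (K n)))
    (L := fun n => tensor I (sval (L n.+1)))
    (k := fun n => tens_map (@idfun I) (k n))
    (p := fun n => tens_map (@idfun I) (p n))
    (i := tens_map (@idfun I) (i 0)) (q := fun n => tens_map (@idfun I) (q n))
    (j := fun n => tens_map (@idfun I) (i n.+1))) => [n|n|n|||n|n|n|n x|x|n x].
  + by have [_ _] := kpP n; exact.
  + exact: (tens_right_exact (kpE n) (pS n)).
  + exact: (tens_map_surj (pS n)).
  + by have [_ _] := iqP 0; exact.
  + exact: (tens_right_exact (iqE 0) (qS 0)).
  + by have [_ _] := iqP n.+1; exact.
  + exact: (tens_right_exact (iqE n.+1) (qS n.+1)).
  + exact: (tens_map_surj (qS n)).
  + exact/esym/tens_map_comp.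
  + exact/esym/tens_map_comp.
  + exact/esym/tens_map_comp.
- exists (i 0); split; first exact: iI.
  move=> y; split=> [[x <-]|[x <-]]; last by exists (p 0 x).
  by have [z <-] := pS 0 x; exists z.
Qed.

(** * Covers and envelopes of Gorenstein flat modules *)

(** The syzygy K = Ker [e] is the image of [dl 0], and the given resolution
    shifted by one place is a complete resolution of K. *)
Lemma gf_flat_cover M : gorenstein_flat M -> flat_cover (@gorenstein_flat R) M.
Proof.
case=> Fl [Fr [dl [e [dr [flatF [dlE dl0E eE drE] tE [i [iI iE]]]]]]].
have [K [k [kI kE]]] := kernel_exists e.
have [p pE] : exists p : {linear Fl 0 -> M}, forall x, i (p x) = e x.
  by apply: mono_lift => // x; apply/iE; exists x.
have pS : surj p.
  move=> m; have [/(_ (ex_intro _ m erefl))[x xm] _] := iE (i m).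
  by exists x; apply: iI; rewrite pE.
have kp : exact_at k p.
  move=> y; rewrite -kE -pE; split=> [->|piy]; first exact: raddf0.
  by apply: iI; rewrite piy raddf0.
have kdl x : (exists y, k y = x) <-> exists y, dl 0 y = x.
  by rewrite -dl0E -kE.
have [s sE] : exists s : {linear Fl 1 -> K}, forall x, k (s x) = dl 0 x.
  by apply: mono_lift => // x; apply/kdl; exists x.
have sS : surj s.
  move=> m; have [/(_ (ex_intro _ m erefl))[x xm] _] := kdl (k m).
  by exists x; apply: kI; rewrite sE.
exists (Fl 0), K, k, p; split => //; first by case: (flatF 0).
- pose Fr' n := if n is n'.+1 then Fr n' else Fl 0.
  pose dr' n : {linear Fr' n -> Fr' n.+1} := if n is n'.+1 then dr n' else e.
  exists (fun n => Fl n.+1), Fr', (fun n => dl n.+1), (dl 0), dr'.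
  split=> [[|n]||I Iinj|]; last by exists k.
  + by split; [have [] := flatF 1 | have [] := flatF 0].
  + by split; [have [] := flatF n.+2 | have [] := flatF n].
  + by split=> // -[|n] //=.
  + by have [? ? ? ?] := tE I Iinj; split=> // -[|n] /=.
- by apply: (image_inj_pure (dlE 0) kI sS) => // I /tE[].
Qed.

(** The cosyzygy is realized as Ker [dr 1] rather than as a quotient of [Fr 0]:
    it must be embedded in [Fr 1] for the shifted resolution. *)
Lemma gf_flat_envelope M :
  gorenstein_flat M -> flat_envelope (@gorenstein_flat R) M.
Proof.
case=> Fl [Fr [dl [e [dr [flatF [dlE dl0E eE drE] tE [i [iI iE]]]]]]].
have [L [k [kI kE]]] := kernel_exists (dr 1).
have [p pE] : exists p : {linear Fl 0 -> M}, forall x, i (p x) = e x.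
  by apply: mono_lift => // x; apply/iE; exists x.
have pS : surj p.
  move=> m; have [/(_ (ex_intro _ m erefl))[x xm] _] := iE (i m).
  by exists x; apply: iI; rewrite pE.
have kdr x : (exists y, k y = x) <-> exists y, dr 0 y = x.
  by rewrite -drE -kE.
have [q qE] : exists q : {linear Fr 0 -> L}, forall x, k (q x) = dr 0 x.
  by apply: mono_lift => // x; apply/kdr; exists x.
have qS : surj q.
  move=> m; have [/(_ (ex_intro _ m erefl))[x xm] _] := kdr (k m).
  by exists x; apply: kI; rewrite qE.
have iq : exact_at i q.
  move=> y; rewrite iE -eE -qE; split=> [->|kqy]; first exact: raddf0.
  by apply: kI; rewrite kqy raddf0.
exists (Fr 0), L, i, q; split => //; first by case: (flatF 0).
- pose Fl' n := if n is n'.+1 then Fl n' else Fr 0.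
  pose dl' n : {linear Fl' n.+1 -> Fl' n} := if n is n'.+1 then dl n' else e.
  exists Fl', (fun n => Fr n.+1), dl', (dr 0), (fun n => dr n.+1).
  split=> [[|n]||I Iinj|]; last by exists k.
  + by split; [have [] := flatF 0 | have [] := flatF 1].
  + by split; [have [] := flatF n | have [] := flatF n.+2].
  + split=> [[|n]|||n]; [exact: dl0E|exact: dlE|exact: eE|exact: (drE 0)|].
    exact: (drE n.+1).
  + have [tl t0 te tr] := tE I Iinj.
    split=> [[|n]|||n]; [exact: t0|exact: tl|exact: te|exact: (tr 0)|].
    exact: (tr n.+1).
- by apply: (image_inj_pure dl0E iI pS) => // I /tE[].
Qed.

(** * Retracts of Gorenstein flat modules *)

Definition gf_retract M :=
  exists (G : lmodType R) (s : {linear M -> G}) (r : {linear G -> M}),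
  gorenstein_flat G /\ cancel s r.

Lemma retract_pure M (G : lmodType R) (s : {linear M -> G}) (r : {linear G -> M}) :
  cancel s r -> forall I : lmodType R^c, injective (tens_map (@idfun I) s).
Proof.
move=> sK I; apply: (can_inj (g := tens_map (@idfun I) r)) => z.
by rewrite (tens_map_comp (I := I) (h := idfun)) ?tens_map_id.
Qed.

Lemma linear_pair A B C (f : {linear A -> B}) (g : {linear A -> C}) :
  exists h : {linear A -> (B * C)%type}, forall x, h x = (f x, g x).
Proof.
pose h x := (f x, g x).
have hL : linear h by move=> t x y; rewrite /h !linearP.
pose hm := GRing.isLinear.Build _ _ _ _ h hL.
by exists (HB.pack_for {linear A -> (B * C)%type} h hm).
Qed.

Lemma linear_copair A B C (f : {linear A -> C}) (g : {linear B -> C}) :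
  exists h : {linear (A * B)%type -> C}, forall x, h x = f x.1 + g x.2.
Proof.
pose h (x : (A * B)%type) := f x.1 + g x.2.
have hL : linear h.
  by move=> t x y; rewrite /h /= !linearP /= scalerDr addrACA.
pose hm := GRing.isLinear.Build _ _ _ _ h hL.
by exists (HB.pack_for {linear (A * B)%type -> C} h hm).
Qed.

Lemma gf_retract_summand (A B : lmodType R) :
  gorenstein_flat (A * B)%type -> gf_retract A.
Proof.
move=> gfAB; have [f fE] := linear_pair (@idfun A) (\0 : {linear A -> B}).
by exists (A * B)%type, f, fst; split=> // x; rewrite fE.
Qed.

(** With K = Ker (F -> G -> M), the map K (+) M -> G, (x, m) |-> p x + s m is
    onto since g = (g - s (r g)) + s (r g), and its kernel is that of p.
    Right exactness applied to this same sequence shows that I (x) K -> I (x) F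
    is injective. *)
Lemma gf_retract_cover M :
  left_GF_closed R -> gf_retract M -> flat_cover gf_retract M.
Proof.
move=> gf_closed; case=> G [s [r [gfG sK]]].
have [F [G' [k [p [Ff gfG' [kI kp pS] kT]]]]] := gf_flat_cover gfG.
have [K [u [uI uE]]] := kernel_exists (r \o p).
have rpS : surj (r \o p).
  by move=> m; have [x xs] := pS (s m); exists x; rewrite /= xs sK.
have pk x : p (k x) = 0 by apply/kp; exists x.
have [v vE] : exists v : {linear G' -> K}, forall x, u (v x) = k x.
  by apply: mono_lift => // x; apply/uE; rewrite /= pk raddf0.
have [a aE] := linear_pair v (\0 : {linear G' -> M}).
have [b bE] := linear_copair (p \o u) s.
have ru x : r (p (u x)) = 0 by apply/uE; exists x.
have aI : injective a.
  by move=> x y; rewrite !aE => -[vxy]; apply: kI; rewrite -!vE vxy.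
have ab : exact_at a b.
  case=> x m; rewrite bE /=; split=> [xm0|[y]]; last first.
    by rewrite aE => -[<- <-]; rewrite vE pk raddf0 addr0.
  have m0 : m = 0.
    by rewrite -(sK m) -[LHS]add0r -(ru x) -raddfD xm0 raddf0.
  move: xm0; rewrite m0 raddf0 addr0 => /kp[y yx].
  by exists y; rewrite aE; congr (_, _); apply: uI; rewrite vE.
have bS : surj b.
  move=> g; have [x xE] := pS (g - s (r g)).
  have /uE[y yx] : (r \o p) x = 0 by rewrite /= xE linearB sK subrr.
  by exists (y, r g); rewrite bE /= yx xE subrK.
have gfKM : gorenstein_flat (K * M)%type.
  exact: (gf_closed _ _ _ a b aI ab bS gfG' gfG).
exists F, K, u, (r \o p); split=> //; first exact: gf_retract_summand gfKM.
move=> I Iinj; apply: raddf_inj => z uz.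
(* Push z into I (x) (K (+) M): its image in I (x) G factors through I (x) F,
   hence vanishes, so z comes from an element y of I (x) G'. *)
have [j jE] := linear_pair (@idfun K) (\0 : {linear K -> M}).
have /(tens_right_exact ab bS)[y yE] :
    tens_map (@idfun I) b (tens_map (@idfun I) j z) = 0.
  rewrite (tens_map_comp (h := p \o u)) => [|x].
    by rewrite -(tens_map_comp (f := u) (g := p)) // uz raddf0.
  by rewrite bE jE /= raddf0 addr0.
have zE : z = tens_map (@idfun I) v y.
  have -> : z = tens_map (@idfun I) fst (tens_map (@idfun I) j z).
    by rewrite (tens_map_comp (h := idfun)) ?tens_map_id // => x; rewrite jE.
  by rewrite -yE; apply: tens_map_comp => x; rewrite aE.
rewrite zE; suff -> : y = 0 by rewrite raddf0.
apply: (kT I Iinj); rewrite raddf0 -uz zE.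
by apply/esym/tens_map_comp.
Qed.

(** With L = F / M, the map G -> L (+) M, g |-> (c (i g), r g) is injective: if
    i g lies in M then g = s m, and r g = 0 forces m = 0. *)
Lemma gf_retract_envelope M :
  left_GF_closed R -> gf_retract M -> flat_envelope gf_retract M.
Proof.
move=> gf_closed; case=> G [s [r [gfG sK]]].
have [F [G' [i [q [Ff gfG' [iI iq qS] iT]]]]] := gf_flat_envelope gfG.
have [L [c [cE cS]]] := cokernel_exists (i \o s).
have qi x : q (i x) = 0 by apply/iq; exists x.
have ci m : c (i (s m)) = 0 by apply/cE; exists m.
have [w wE] : exists w : {linear L -> G'}, forall x, w (c x) = q x.
  by apply: epi_factor => // x /cE[m <-] /=; exact: qi.
have [a aE] := linear_pair (c \o i) r.
have [b bE] := linear_copair w (\0 : {linear M -> G'}).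
have aI : injective a.
  apply: raddf_inj => g ag; have := aE g.
  rewrite [a g]ag => -[/esym/cE[m /iI sm] /esym rg].
  by rewrite -sm -(sK m) sm rg raddf0.
have ab : exact_at a b.
  case=> x m; rewrite bE /= addr0; split=> [|[g]]; last first.
    by rewrite aE => -[<- _]; rewrite wE.
  have [f <-] := cS x; rewrite wE => /iq[g <-].
  (* Correct g inside M, which is invisible in L, to obtain r g = m. *)
  exists (g - s (r g) + s m); rewrite aE /=; congr (_, _).
    by rewrite !linearD !linearN /= !ci subr0 addr0.
  by rewrite linearD linearB /= !sK subrr add0r.
have bS : surj b.
  move=> z; have [f <-] := qS z; exists (c f, 0).
  by rewrite bE /= addr0 wE.
have gfLM : gorenstein_flat (L * M)%type.
  exact: (gf_closed _ _ _ a b aI ab bS gfG gfG').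
exists F, L, (i \o s), c; split=> //; first exact: gf_retract_summand gfLM.
  by split=> // x y /iI /(can_inj sK).
move=> I Iinj x y.
rewrite -!(tens_map_comp (f := s) (g := i) (h := i \o s)) //.
by move=> /(iT I Iinj) /(retract_pure sK).
Qed.

End Steps.

Theorem corollary2p6 (R : pzRingType) :
  left_GF_closed R -> closed_under_direct_summands (@gorenstein_flat R).
Proof.
move=> gf_closed M G [N [phi [psi phiK psiK]]] gfG.
apply: (@gf_of_steps R (@gf_retract R)) => [X|X|].
- exact: gf_retract_cover.
- exact: gf_retract_envelope.
have [j jE] := linear_pair (@idfun M) (\0 : {linear M -> N}).
pose psim := GRing.isLinear.Build _ _ _ _ psi (can2_linear phiK psiK).
pose psiL := HB.pack_for {linear G -> (M * N)%type} psi psim.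
by exists G, (phi \o j), (fst \o psiL); split=> // x /=; rewrite phiK jE.
Qed.
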